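(* Let $\Delta t>0$, let $\boldsymbol m_h^n=(m_1^n,m_2^n,m_3^n)$ be any $\mathbb R^3$-valued grid function, and let $\boldsymbol m_h^{n+1}=(m_1^{n+1},m_2^{n+1},m_3^{n+1})$ be the grid function produced from $\boldsymbol m_h^n$ by one time step (Steps 1--3) of the fractional-step Gauss--Seidel Crank--Nicolson scheme for $\boldsymbol m_t=-\boldsymbol m\times\Delta\boldsymbol m$ described in the context. Then the scheme preserves length: at every grid point, $$|\boldsymbol m_h^{n+1}|^2=|\boldsymbol m_h^{n}|^2,$$ where $|\cdot|$ is the Euclidean norm in $\mathbb R^3$.
   Context: Grid: $\Omega=\prod_{j=1}^d(0,L_j)\subset\mathbb R^d$, $d\in\{1,2,3\}$, with a uniform cell-centred grid of mesh size $h$ ($L_j/h$ a positive integer for each $j$). $\Delta_h$ is the standard second-order central-difference Laplacian on scalar grid functions (in each direction $(u_{i+1}-2u_i+u_{i-1})/h^2$), with homogeneous Neumann boundary condition imposed by even reflection (ghost value equals the value in the adjacent interior cell). It acts componentwise on vector grid functions. For a scalar grid function $u$ put $G(u)=(I-\Delta t\,\Delta_h)^{-1}u$. Given $\boldsymbol m_h^n=(m_1^n,m_2^n,m_3^n)$, set $g_j^n=G(m_j^n)$, $j=1,2,3$. For grid functions $q_1,q_2,q_3$ let $$R(q)=\begin{pmatrix} m_1^n+\frac{\Delta t}{2}(q_2m_3^n-q_3m_2^n)\\ m_2^n+\frac{\Delta t}{2}(q_3m_1^n-q_1m_3^n)\\ m_3^n+\frac{\Delta t}{2}(q_1m_2^n-q_2m_1^n)\end{pmatrix}.$$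 All products are pointwise, and the $3\times3$ systems below are solved at each grid point. Step 1. With $q=(\Delta_hg_1^n,\Delta_hg_2^n,\Delta_hg_3^n)$ solve $$\begin{pmatrix}1&\frac{\Delta t}{2}q_3&-\frac{\Delta t}{2}q_2\\0&1&0\\0&0&1\end{pmatrix}\boldsymbol m^{*}=R(q),$$ and set $g_1^{n+1}=G(m_1^{*})$. Step 2. With $q=(\Delta_hg_1^{n+1},\Delta_hg_2^n,\Delta_hg_3^n)$ solve $$\begin{pmatrix}1&\frac{\Delta t}{2}q_3&-\frac{\Delta t}{2}q_2\\-\frac{\Delta t}{2}q_3&1&\frac{\Delta t}{2}q_1\\0&0&1\end{pmatrix}\boldsymbol m^{**}=R(q),$$ and set $g_2^{n+1}=G(m_2^{**})$. Step 3. With $q=(\Delta_hg_1^{n+1},\Delta_hg_2^{n+1},\Delta_hg_3^n)$ solve $$\begin{pmatrix}1&\frac{\Delta t}{2}q_3&-\frac{\Delta t}{2}q_2\\-\frac{\Delta t}{2}q_3&1&\frac{\Delta t}{2}q_1\\\frac{\Delta t}{2}q_2&-\frac{\Delta t}{2}q_1&1\end{pmatrix}\boldsymbol m_h^{n+1}=R(q).$$ *)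

(* Defs.v *)
From HB Require Import structures.
From mathcomp Require Import all_boot all_order all_algebra.
From mathcomp Require Import reals.
From mathcomp Require Import ring lra.

Set Implicit Arguments.
Unset Strict Implicit.
Unset Printing Implicit Defensive.

Import Order.TTheory GRing.Theory Num.Theory.
Local Open Scope ring_scope.

(* Cells of the grid: multi-indices (i_1, .., i_d) with 0 <= i_j < N j, the
   cell i being centred at the point with coordinates (i_j + 1/2) h. *)
Definition grid (d : nat) (N : 'I_d -> nat) : finType :=
  {dffun forall j : 'I_d, 'I_(N j)}.

(* Real-valued grid functions; R^o gives them their vector space structure. *)
Notation gridfun R N := {ffun grid N -> R^o}.
Notation gridvec R N := {ffun grid N -> 'cV[R]_3}.

(* Index of the next (previous) cell along an axis with n cells.  At the
   boundary it is the cell itself: the ghost value prescribed by even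
   reflection is the value in the adjacent interior cell. *)
Definition next_cell (n : nat) (i : 'I_n) : 'I_n := insubd i i.+1.
Definition prev_cell (n : nat) (i : 'I_n) : 'I_n := insubd i i.-1.

Section Grid.
Variables (R : realType) (d : nat) (N : 'I_d -> nat).

Definition fwd (j : 'I_d) (x : grid N) : grid N :=
  [ffun k => if k == j then next_cell (x k) else x k].

Definition bwd (j : 'I_d) (x : grid N) : grid N :=
  [ffun k => if k == j then prev_cell (x k) else x k].

Definition laplacian (h : R) (u : gridfun R N) : gridfun R N :=
  [ffun x => \sum_(j < d) (u (fwd j x) - 2 * u x + u (bwd j x)) / h ^+ 2].

Fact laplacian_is_linear h : linear (laplacian h).
Proof.
move=> a u v; apply/ffunP => x; rewrite !ffunE /GRing.scale /=.
rewrite mulr_sumr -big_split /=; apply: eq_bigr => j _.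
by rewrite !ffunE /GRing.scale /=; ring.
Qed.

HB.instance Definition _ h :=
  GRing.isLinear.Build R (gridfun R N) (gridfun R N) _ (laplacian h)
    (laplacian_is_linear h).

Definition helmholtz (dt h : R) : 'End(gridfun R N) :=
  (\1 - dt *: linfun (laplacian h))%VF.

(* The inverse of an endomorphism is a priori only a partial inverse; it is a
   genuine two-sided inverse here, see [helmholtzK] and [GK] below. *)
Definition G (dt h : R) (u : gridfun R N) : gridfun R N :=
  (helmholtz dt h)^-1%VF u.

End Grid.

Section Scheme.
Variable R : realType.

Definition c1 : 'I_3 := @Ordinal 3 0 isT.
Definition c2 : 'I_3 := @Ordinal 3 1 isT.
Definition c3 : 'I_3 := @Ordinal 3 2 isT.

Definition col3 (a b c : R) : 'cV[R]_3 :=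
  \col_i nth 0 [:: a; b; c] i.

Definition mx3 (a b c : seq R) : 'M[R]_3 :=
  \matrix_(i, j) nth 0 (nth [::] [:: a; b; c] i) j.

(* Euclidean norm (the library norm on matrices is the maximum norm). *)
Definition enorm (v : 'cV[R]_3) : R := Num.sqrt (\sum_i v i 0 ^+ 2).

Definition rhs (dt : R) (q m : 'cV[R]_3) : 'cV[R]_3 :=
  let q1 := q c1 0 in let q2 := q c2 0 in let q3 := q c3 0 in
  let m1 := m c1 0 in let m2 := m c2 0 in let m3 := m c3 0 in
  col3 (m1 + dt / 2 * (q2 * m3 - q3 * m2))
       (m2 + dt / 2 * (q3 * m1 - q1 * m3))
       (m3 + dt / 2 * (q1 * m2 - q2 * m1)).

Definition mx_step1 (dt : R) (q : 'cV[R]_3) : 'M[R]_3 :=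
  let q2 := q c2 0 in let q3 := q c3 0 in
  mx3 [:: 1; dt / 2 * q3; - (dt / 2 * q2)]
      [:: 0; 1; 0]
      [:: 0; 0; 1].

Definition mx_step2 (dt : R) (q : 'cV[R]_3) : 'M[R]_3 :=
  let q1 := q c1 0 in let q2 := q c2 0 in let q3 := q c3 0 in
  mx3 [:: 1; dt / 2 * q3; - (dt / 2 * q2)]
      [:: - (dt / 2 * q3); 1; dt / 2 * q1]
      [:: 0; 0; 1].

Definition mx_step3 (dt : R) (q : 'cV[R]_3) : 'M[R]_3 :=
  let q1 := q c1 0 in let q2 := q c2 0 in let q3 := q c3 0 in
  mx3 [:: 1; dt / 2 * q3; - (dt / 2 * q2)]
      [:: - (dt / 2 * q3); 1; dt / 2 * q1]
      [:: dt / 2 * q2; - (dt / 2 * q1); 1].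

Variables (d : nat) (N : 'I_d -> nat).

Definition component (i : 'I_3) (m : gridvec R N) : gridfun R N :=
  [ffun x => m x i 0].

Definition lap3 (h : R) (u1 u2 u3 : gridfun R N) : gridvec R N :=
  [ffun x => col3 (laplacian h u1 x) (laplacian h u2 x) (laplacian h u3 x)].

(* [gscn_step dt h m m'] : m' is produced from m by one time step; ms and mss
   are the intermediate fields m^* and m^**, and g1', g2' the updated g_1, g_2.
   See [gscn_step_exists_unique] below for well-posedness. *)
Definition gscn_step (dt h : R) (m m' : gridvec R N) : Prop :=
  exists ms mss : gridvec R N,
    let g1 := G dt h (component c1 m) in
    let g2 := G dt h (component c2 m) in
    let g3 := G dt h (component c3 m) in
    let g1' := G dt h (component c1 ms) in
    let g2' := G dt h (component c2 mss) in
    [/\ forall x, let q := lap3 h g1 g2 g3 x in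
          mx_step1 dt q *m ms x = rhs dt q (m x),
        forall x, let q := lap3 h g1' g2 g3 x in
          mx_step2 dt q *m mss x = rhs dt q (m x)
      & forall x, let q := lap3 h g1' g2' g3 x in
          mx_step3 dt q *m m' x = rhs dt q (m x)].

End Scheme.

Section WellPosed.
Variables (R : realType) (d : nat) (N : 'I_d -> nat) (dt h : R).
Hypothesis dt_gt0 : 0 < dt.

Lemma helmholtzE (u : gridfun R N) x :
  helmholtz N dt h u x = u x - dt * laplacian h u x.
Proof.
by rewrite /helmholtz add_lfunE opp_lfunE scale_lfunE id_lfunE lfunE !ffunE.
Qed.

Lemma helmholtz_le0 (u : gridfun R N) :
  helmholtz N dt h u = 0 -> forall x, u x <= 0.
Proof.
move=> u0 x.
have [y _ ymax] := arg_maxP u (isT : predT x).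
apply: le_trans (ymax x isT) _.
have := helmholtzE u y; rewrite u0 ffunE => /esym/eqP.
rewrite subr_eq0 => /eqP ->.
rewrite pmulr_rle0 // ffunE; apply: sumr_le0 => j _.
rewrite mulr_le0_ge0 ?invr_ge0 ?sqr_ge0 //.
have /= uf := ymax (fwd j y) isT; have /= ub := ymax (bwd j y) isT.
suff: (u (fwd j y) : R) + u (bwd j y) <= u y + u y by lra.
exact: lerD.
Qed.

Lemma helmholtz_lker0 : lker (helmholtz N dt h) == 0%VS.
Proof.
apply/lker0P => u v uv; apply/eqP; rewrite -subr_eq0; apply/eqP.
have w0 : helmholtz N dt h (u - v) = 0 by rewrite linearB /= uv subrr.
have w0' : helmholtz N dt h (v - u) = 0 by rewrite linearB /= uv subrr.
apply/ffunP => x.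
have := helmholtz_le0 w0 x; have := helmholtz_le0 w0' x.
rewrite !ffunE => a b; apply/eqP; rewrite eq_le b /=.
by rewrite -oppr_le0 opprB.
Qed.

Lemma helmholtzK : cancel (helmholtz N dt h) (@G R d N dt h).
Proof. exact: lker0_lfunK helmholtz_lker0. Qed.

Lemma GK : cancel (@G R d N dt h) (helmholtz N dt h).
Proof. exact: lker0_lfunVK helmholtz_lker0. Qed.

Lemma det_mx2 (A : 'M[R]_2) :
  \det A = A 0 0 * A 1 1 - A 0 1 * A 1 0.
Proof.
rewrite (expand_det_row _ 0) !big_ord_recl big_ord0 /cofactor !det_mx11 !mxE /=.
rewrite expr0 expr1 mul1r mulN1r mulrN addr0.
by congr (A _ _ * A _ _ - A _ _ * A _ _); apply: val_inj.
Qed.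

Lemma det_mx3 a11 a12 a13 a21 a22 a23 a31 a32 a33 :
  \det (mx3 [:: a11; a12; a13] [:: a21; a22; a23] [:: a31; a32; a33] : 'M[R]_3)
  = a11 * (a22 * a33 - a23 * a32) - a12 * (a21 * a33 - a23 * a31)
    + a13 * (a21 * a32 - a22 * a31).
Proof.
rewrite (expand_det_row _ ord0) !big_ord_recl big_ord0 /cofactor !det_mx2.
by rewrite !mxE /=; ring.
Qed.

Lemma mx_step1_unit q : mx_step1 dt q \in unitmx.
Proof.
by rewrite unitmxE det_mx3 (_ : _ + _ = 1) ?unitr1 //; ring.
Qed.

Lemma mx_step2_unit q : mx_step2 dt q \in unitmx.
Proof.
rewrite unitmxE det_mx3 unitfE gt_eqF //.
have := sqr_ge0 (dt / 2 * q c3 0); rewrite expr2; lra.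
Qed.

Lemma mx_step3_unit q : mx_step3 dt q \in unitmx.
Proof.
rewrite unitmxE det_mx3 unitfE gt_eqF //.
have := sqr_ge0 (dt / 2 * q c1 0); have := sqr_ge0 (dt / 2 * q c2 0).
have := sqr_ge0 (dt / 2 * q c3 0); rewrite !expr2; nra.
Qed.

Lemma solve_unique (A : grid N -> 'M[R]_3) (b : grid N -> 'cV[R]_3) :
  (forall x, A x \in unitmx) ->
  exists! m : gridvec R N, forall x, A x *m m x = b x.
Proof.
move=> uA; exists [ffun x => invmx (A x) *m b x]; split=> [x|m mE].
  by rewrite ffunE mulKVmx.
by apply/ffunP => x; rewrite ffunE -mE mulKmx.
Qed.

Theorem gscn_step_exists_unique (m : gridvec R N) :
  exists! m' : gridvec R N, gscn_step dt h m m'.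
Proof.
pose q1 := lap3 h (G dt h (component c1 m)) (G dt h (component c2 m)) (G dt h (component c3 m)).
pose q2 (ms : gridvec R N) :=
  lap3 h (G dt h (component c1 ms)) (G dt h (component c2 m)) (G dt h (component c3 m)).
pose q3 (ms mss : gridvec R N) :=
  lap3 h (G dt h (component c1 ms)) (G dt h (component c2 mss)) (G dt h (component c3 m)).
have [ms [msE msU]] := solve_unique (fun x => rhs dt (q1 x) (m x))
  (fun x => mx_step1_unit (q1 x)).
have [mss [mssE mssU]] := solve_unique (fun x => rhs dt (q2 ms x) (m x))
  (fun x => mx_step2_unit (q2 ms x)).
have [m' [m'E m'U]] := solve_unique (fun x => rhs dt (q3 ms mss x) (m x))
  (fun x => mx_step3_unit (q3 ms mss x)).
exists m'; split; first by exists ms, mss; split.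
move=> m'' [ms' [mss' [/= e1 e2 e3]]].
have ? : ms = ms' by exact: msU.
subst ms'; have ? : mss = mss' by exact: mssU.
by subst mss'; exact: m'U.
Qed.

End WellPosed.

(* Main.v *)
(** With [a = dt/2 q], Step 3 reads [m' - m = a x (m' + m)] pointwise; taking the
    inner product with [m' + m] gives [|m'|^2 - |m|^2 = 0], whatever [q] is. *)
Require Import Defs.
From HB Require Import structures.
From mathcomp Require Import all_boot all_order all_algebra.
From mathcomp Require Import reals.
From mathcomp Require Import lra.

Set Implicit Arguments.
Unset Strict Implicit.
Unset Printing Implicit Defensive.

Import Order.TTheory GRing.Theory Num.Theory.
Local Open Scope ring_scope.

(** Equivalently, with S the skew matrix of the cross product by a, [mx_step3] is I - S and [rhs] is
    (I + S) m, so Step 3 is a Cayley transform, hence a rotation at each grid point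
    ([mx_step3_enorm]). *)

Lemma sum_ord3 (V : nmodType) (F : 'I_3 -> V) :
  \sum_i F i = F c1 + F c2 + F c3.
Proof.
rewrite !big_ord_recl big_ord0 addr0 addrA.
by congr (F _ + F _ + F _); apply: val_inj.
Qed.

Lemma mx_step3_enorm (R : realType) (dt : R) (q v w : 'cV[R]_3) :
  mx_step3 dt q *m w = rhs dt q v -> enorm w = enorm v.
Proof.
move=> /colP e; congr Num.sqrt; rewrite !sum_ord3.
move: (e c1) (e c2) (e c3); rewrite !mxE !sum_ord3 !mxE /=.
set a := dt / 2; move=> e1 e2 e3.
(* Each row is multiplied by the matching entry of w + v; in the sum of the three products the terms
   in q cancel by skew-symmetry, so [lra] needs only linear arithmetic over monomials. *)
have := congr1 ( *%R (w c1 0 + v c1 0)) e1.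
have := congr1 ( *%R (w c2 0 + v c2 0)) e2.
have := congr1 ( *%R (w c3 0 + v c3 0)) e3.
lra.
Qed.

Theorem mainTheorem1 (R : realType) (d : nat) (hd : (1 <= d <= 3)%N)
  (L : 'I_d -> R) (h : R) (h_gt0 : 0 < h)
  (N : 'I_d -> nat) (N_gt0 : forall j, (0 < N j)%N)
  (hL : forall j, L j / h = (N j)%:R)
  (dt : R) (dt_gt0 : 0 < dt)
  (m m' : gridvec R N) (hm' : gscn_step dt h m m') :
  forall x : grid N, enorm (m' x) ^+ 2 = enorm (m x) ^+ 2.
Proof.
by case: hm' => ms [mss [_ _ step3]] x; rewrite (mx_step3_enorm (step3 x)).
Qed.
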